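(* Let the descriptor system $Ex(t+1)=Ax(t)+Bu(t)$, $y(t)=Cx(t)+Du(t)$ be regular, R-controllable and R-observable, with quasi-Weierstraß dimension $q$ and nilpotency index $s$. Let $L,T\in\mathbb N$, let $Q\in\mathbb R^{p\times p}$ and $R\in\mathbb R^{m\times m}$ be symmetric positive definite, let $t\in\mathbb N_0$ with $t\ge q+s-1$, let $(u,y)\in\mathfrak B_{\mathrm m}[t-q-s+1,t-1]$, and let $(\bar u,\bar y)\in\mathfrak B_{\mathrm m}[0,T-1]$ be such that $\bar u$ is persistently exciting of order $L+2(q+s-1)$. Consider the optimal control problem (OCP-A): minimize over $(\hat u,\hat y)$ $$\sum_{k=0}^{L-1}\|\hat y(t+k)\|_Q^2+\|\hat u(t+k)\|_R^2$$ subject to $(\hat u,\hat y)\in\mathfrak B_{\mathrm m}[t-q-s+1,t+L-1]$ and $$\begin{bmatrix}\hat{\mathbf u}_{[t-q-s+1,t-1]}\\ \hat{\mathbf y}_{[t-q-s+1,t-1]}\end{bmatrix}=\begin{bmatrix}\mathbf u_{[t-q-s+1,t-1]}\\ \mathbf y_{[t-q-s+1,t-1]}\end{bmatrix},\qquad \begin{bmatrix}\hat{\mathbf u}_{[t+L-q-s+1,t+L-1]}\\ \hat{\mathbf y}_{[t+L-q-s+1,t+L-1]}\end{bmatrix}=\begin{bmatrix}0\\0\end{bmatrix}.$$ Consider also the optimal control problem (OCP-B): minimize over functions $(\hat u,\hat y):[t-q-s+1:t+L-1]\to\mathbb R^m\times\mathbb R^p$ and vectors $\alpha(t)\in\mathbb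 R^{T-L-2s-q+3}$ the same objective $\sum_{k=0}^{L-1}\|\hat y(t+k)\|_Q^2+\|\hat u(t+k)\|_R^2$ subject to $$\begin{bmatrix}\hat{\mathbf u}_{[t-q-s+1,t+L-1]}\\ \hat{\mathbf y}_{[t-q-s+1,t+L-1]}\end{bmatrix}=\begin{bmatrix}H_{L+q+s-1}(\bar{\mathbf u}_{[0,T-s]})\\ H_{L+q+s-1}(\bar{\mathbf y}_{[0,T-s]})\end{bmatrix}\alpha(t)$$ and the same two further equality constraints $$\begin{bmatrix}\hat{\mathbf u}_{[t-q-s+1,t-1]}\\ \hat{\mathbf y}_{[t-q-s+1,t-1]}\end{bmatrix}=\begin{bmatrix}\mathbf u_{[t-q-s+1,t-1]}\\ \mathbf y_{[t-q-s+1,t-1]}\end{bmatrix},\qquad \begin{bmatrix}\hat{\mathbf u}_{[t+L-q-s+1,t+L-1]}\\ \hat{\mathbf y}_{[t+L-q-s+1,t+L-1]}\end{bmatrix}=\begin{bmatrix}0\\0\end{bmatrix}.$$ Then (OCP-A) and (OCP-B) are equivalent, i.e.: (a) (OCP-A) is feasible if and only if (OCP-B) is feasible; (b) for every optimal solution $(u^\star,y^\star)\in\mathfrak B_{\mathrm m}[t-q-s+1,t+L-1]$ of (OCP-A) there exists $\alpha^\star(t)\in\mathbb R^{T-L-2s-q+3}$ such that $(u^\star,y^\star,\alpha^\star(t))$ is an optimal solution of (OCP-B); (c) for every optimal solution $(u^\star,y^\star,\alpha^\star(t))$ of (OCP-B), $(u^\star,y^\star)$ is contained in $\mathfrak B_{\mathrm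 m}[t-q-s+1,t+L-1]$ and is optimal for (OCP-A).
   Context: Notation: $\mathbb N_0=\{0,1,2,\dots\}$, $\mathbb N=\{1,2,\dots\}$, $[a:b]=[a,b]\cap\mathbb N_0$, and $\|x\|_Q=(x^\top Qx)^{1/2}$ for symmetric positive definite $Q$. System: $A,E\in\mathbb R^{n\times n}$, $B\in\mathbb R^{n\times m}$, $C\in\mathbb R^{p\times n}$, $D\in\mathbb R^{p\times m}$; $E$ may be singular. The system is regular if $\det(\lambda E-A)\ne0$ for some $\lambda\in\mathbb C$. It is R-controllable if $\operatorname{rk}[\lambda E-A\;\;B]=n$ for all $\lambda\in\mathbb C$, and R-observable if $\operatorname{rk}\begin{bmatrix}\lambda E-A\\ C\end{bmatrix}=n$ for all $\lambda\in\mathbb C$. Quasi-Weierstraß form: by regularity there are invertible $S,P\in\mathbb R^{n\times n}$ with $SEP=\begin{bmatrix}I_q&0\\0&N\end{bmatrix}$ and $SAP=\begin{bmatrix}A_1&0\\0&I_r\end{bmatrix}$, where $A_1\in\mathbb R^{q\times q}$, $q+r=n$, and $N\in\mathbb R^{r\times r}$ is nilpotent with nilpotency index $s$ (the smallest $s\ge1$ with $N^s=0$; $s=1$ if $r=0$). The numbers $q,r,s$ do not depend on the choice of $S,P$. Behaviors: the full behavior $\mathfrak B_{\mathrm f}$ is the set of all $(x,u,y):\mathbb N_0\to\mathbb R^n\times\mathbb R^m\times\mathbb R^p$ satisfying the two system equations for all times in $\mathbb N_0$. The manifest behavior $\mathfrak B_{\mathrm m}$ is the set of all $(u,y):\mathbb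 N_0\to\mathbb R^m\times\mathbb R^p$ for which there exists $x:\mathbb N_0\to\mathbb R^n$ with $(x,u,y)\in\mathfrak B_{\mathrm f}$. For $a\le b$ in $\mathbb N_0$, $\mathfrak B_{\mathrm m}[a,b]=\{w|_{[a:b]} : w\in\mathfrak B_{\mathrm m}\}$. Vectorization and Hankel matrices: for a function $f$ with values in $\mathbb R^k$ defined (at least) on $[a:b]$, $\mathbf f_{[a,b]}=[f(a)^\top\ \cdots\ f(b)^\top]^\top\in\mathbb R^{k(b-a+1)}$. For $K\in\mathbb N$, $K\le b-a+1$, the Hankel matrix $H_K(\mathbf f_{[a,b]})\in\mathbb R^{kK\times(b-a-K+2)}$ is the matrix whose $j$-th column ($j=0,\dots,b-a-K+1$) is $\mathbf f_{[a+j,a+j+K-1]}$. Persistency of excitation: $u:[0:T-1]\to\mathbb R^m$ is persistently exciting of order $K$ if $H_K(\mathbf u_{[0,T-1]})$ has rank $mK$. A problem is feasible if some point satisfies all its constraints; an optimal solution is a feasible point minimizing the objective among all feasible points. *)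

(* Defs.v *)
From HB Require Import structures.
From mathcomp Require Import all_boot all_order all_algebra.
From mathcomp Require Import reals.
From mathcomp Require Import complex.
From mathcomp Require Import zify.

Set Implicit Arguments.
Unset Strict Implicit.
Unset Printing Implicit Defensive.

Import Order.TTheory GRing.Theory Num.Theory.
Local Open Scope ring_scope.

Section DescriptorSystem.
Variables (R : realType) (n m p : nat).

Record descriptor := Descriptor {
  sysE : 'M[R]_n;
  sysA : 'M[R]_n;
  sysB : 'M[R]_(n, m);
  sysC : 'M[R]_(p, n);
  sysD : 'M[R]_(p, m) }.

Variable sys : descriptor.

Definition cmx a b (M : 'M[R]_(a, b)) : 'M[R[i]]_(a, b) :=
  map_mx (real_complex R) M.

Definition pencil (lam : R[i]) : 'M[R[i]]_n :=
  lam *: cmx (sysE sys) - cmx (sysA sys).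

Definition regular : Prop := exists lam : R[i], \det (pencil lam) != 0.

Definition R_controllable : Prop :=
  forall lam : R[i], \rank (row_mx (pencil lam) (cmx (sysB sys))) = n.

Definition R_observable : Prop :=
  forall lam : R[i], \rank (col_mx (pencil lam) (cmx (sysC sys))) = n.

Definition full_behavior (x : nat -> 'cV[R]_n) (u : nat -> 'cV[R]_m)
    (y : nat -> 'cV[R]_p) : Prop :=
  forall k : nat,
    sysE sys *m x k.+1 = sysA sys *m x k + sysB sys *m u k /\
    y k = sysC sys *m x k + sysD sys *m u k.

Definition manifest_behavior (u : nat -> 'cV[R]_m) (y : nat -> 'cV[R]_p) :
    Prop :=
  exists x : nat -> 'cV[R]_n, full_behavior x u y.

End DescriptorSystem.

(* For r = 0 the unique 0 x 0 matrix has index 1, since s must be positive. *)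
Definition nilpotency_index (R : realType) (r : nat) (N : 'M[R]_r) (s : nat) :
    Prop :=
  [/\ (0 < s)%N, N ^+ s = 0
    & forall k : nat, (0 < k)%N -> N ^+ k = 0 -> (s <= k)%N].

Definition quasi_weierstrass (R : realType) (n m p : nat)
    (sys : descriptor R n m p) (q s : nat) : Prop :=
  exists (r : nat) (qr_n : (q + r = n)%N) (S P : 'M[R]_n)
         (A1 : 'M[R]_q) (N : 'M[R]_r),
    [/\ S \in unitmx, P \in unitmx,
        S *m sysE sys *m P = castmx (qr_n, qr_n) (block_mx 1%:M 0 0 N),
        S *m sysA sys *m P = castmx (qr_n, qr_n) (block_mx A1 0 0 1%:M)
      & nilpotency_index N s].

(* Finite time intervals are given by their start [a] and their length [len]:
   [window a len] is {a, ..., a + len - 1}.  Thus the empty interval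
   "[t : t - 1]" is [window t 0], also for t = 0. *)
Definition window (a len : nat) := {k : nat | (a <= k < a + len)%N}.

(* The values of [f] at the times of its window (and 0 at all other times), so
   that vectorization need only be defined for functions of all times; below,
   only values inside the window are ever used. *)
Definition at_time (R : realType) (d a len : nat)
    (f : window a len -> 'cV[R]_d) (k : nat) : 'cV[R]_d :=
  if insub k is Some i then f i else 0.

(* B_m[a, a + len - 1] *)
Definition manifest_on (R : realType) (n m p : nat) (sys : descriptor R n m p)
    (a len : nat)
    (u : window a len -> 'cV[R]_m) (y : window a len -> 'cV[R]_p) : Prop :=
  exists (u' : nat -> 'cV[R]_m) (y' : nat -> 'cV[R]_p),
    [/\ manifest_behavior sys u' y',
        forall k : window a len, u k = u' (val k)
      & forall k : window a len, y k = y' (val k)].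

(* The vector f_[a, a + K - 1]. *)
Definition stack (R : realType) (d : nat) (a K : nat) (f : nat -> 'cV[R]_d) :
    'cV[R]_(\sum_(i < K) d) :=
  \mxcol_(i < K) f (a + i)%N.

(* H_K(f_[a, a + len - 1]); it is only used with 0 < K <= len, and then has
   len - K + 1 columns. *)
Definition hankel (R : realType) (d : nat) (K a len : nat)
    (f : nat -> 'cV[R]_d) : 'M[R]_(\sum_(i < K) d, len - K + 1) :=
  \matrix_(i, j) stack (a + j) K f i 0.

Definition persistently_exciting (R : realType) (m T : nat)
    (u : window 0 T -> 'cV[R]_m) (K : nat) : Prop :=
  (0 < K <= T)%N /\ \rank (hankel K 0 T (at_time u)) = (m * K)%N.

Definition sym_posdef (R : realType) (d : nat) (Q : 'M[R]_d) : Prop :=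
  Q^T = Q /\ forall x : 'cV[R]_d, x != 0 -> 0 < (x^T *m Q *m x) 0 0.

Definition wnorm (R : realType) (d : nat) (Q : 'M[R]_d) (x : 'cV[R]_d) : R :=
  Num.sqrt ((x^T *m Q *m x) 0 0).

Definition feasible (X : Type) (constr : X -> Prop) : Prop :=
  exists z : X, constr z.

Definition optimal (R : realType) (X : Type) (constr : X -> Prop) (J : X -> R)
    (z : X) : Prop :=
  constr z /\ forall z' : X, constr z' -> J z <= J z'.

(* In the optimal control problems [l] plays the role of q + s - 1, so that
   [window (t - l) (L + l)] is [t - q - s + 1 : t + L - 1]. *)
Section OptimalControl.
Variables (R : realType) (n m p : nat) (sys : descriptor R n m p).
Variables (l L t : nat).

Definition io_pair : Type :=
  ((window (t - l) (L + l) -> 'cV[R]_m) *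
   (window (t - l) (L + l) -> 'cV[R]_p))%type.

Definition ocp_cost (Q : 'M[R]_p) (W : 'M[R]_m) (w : io_pair) : R :=
  \sum_(0 <= k < L) (wnorm Q (at_time w.2 (t + k)) ^+ 2 +
                     wnorm W (at_time w.1 (t + k)) ^+ 2).

Definition initial_constraint (u : window (t - l) l -> 'cV[R]_m)
    (y : window (t - l) l -> 'cV[R]_p) (w : io_pair) : Prop :=
  col_mx (stack (t - l) l (at_time w.1)) (stack (t - l) l (at_time w.2)) =
  col_mx (stack (t - l) l (at_time u)) (stack (t - l) l (at_time y)).

Definition terminal_constraint (w : io_pair) : Prop :=
  col_mx (stack (t + L - l) l (at_time w.1))
         (stack (t + L - l) l (at_time w.2)) = col_mx 0 0.

Definition ocpA_constraints (u : window (t - l) l -> 'cV[R]_m)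
    (y : window (t - l) l -> 'cV[R]_p) (w : io_pair) : Prop :=
  [/\ manifest_on sys w.1 w.2, initial_constraint u y w
    & terminal_constraint w].

(* The data are used on [0 : T - s], an interval of length T - s + 1; this is
   the number of columns of the resulting Hankel matrices of order L + l. *)
Definition alpha_dim (T s : nat) : nat := T - s + 1 - (L + l) + 1.

Definition ocpB_constraints (T s : nat)
    (ud : window 0 T -> 'cV[R]_m) (yd : window 0 T -> 'cV[R]_p)
    (u : window (t - l) l -> 'cV[R]_m) (y : window (t - l) l -> 'cV[R]_p)
    (z : io_pair * 'cV[R]_(alpha_dim T s)) : Prop :=
  [/\ col_mx (stack (t - l) (L + l) (at_time z.1.1))
             (stack (t - l) (L + l) (at_time z.1.2)) =
      col_mx (hankel (L + l) 0 (T - s + 1) (at_time ud))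
             (hankel (L + l) 0 (T - s + 1) (at_time yd)) *m z.2,
      initial_constraint u y z.1
    & terminal_constraint z.1].

Definition ocpB_cost (T s : nat) (Q : 'M[R]_p) (W : 'M[R]_m)
    (z : io_pair * 'cV[R]_(alpha_dim T s)) : R :=
  ocp_cost Q W z.1.

End OptimalControl.

Lemma alpha_dimE (q s L T : nat) :
  (0 < s)%N -> (0 < L)%N -> (L + 2 * (q + s - 1) <= T)%N ->
  alpha_dim (q + s - 1) L T s = (T + 3 - L - 2 * s - q)%N.
Proof. by rewrite /alpha_dim; lia. Qed.

(* Main.v *)
Require Import Defs.
From mathcomp Require Import all_boot all_order all_algebra.
From mathcomp Require Import reals complex zify.
Import Order.TTheory GRing.Theory Num.Theory.
Local Open Scope ring_scope.

Set Implicit Arguments.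
Unset Strict Implicit.
Unset Printing Implicit Defensive.

(** The two problems have the same cost, so everything reduces to one equality
    of sets: with [l = q + s - 1], the restrictions of manifest trajectories to
    a window of length [L + l] are exactly the combinations of the columns of
    the data Hankel matrices ([ocp_constraints_equiv]).  This is a version of
    Willems' fundamental lemma for descriptor systems.

    In quasi-Weierstrass coordinates the nilpotent part of the state is
    determined by present and future inputs, through at most [s] terms.  So
    a manifest trajectory is governed by an ordinary system
    [z (k+1) = A z k + B u k] of order [q], whose output
    [y k = C z k + \sum_(i < s) F i u (k+i)] looks [s - 1] steps ahead
    ([quasi_weierstrass_slow_trajectory]).  R-controllability becomes the
    Hautus condition for [(A, B)], for every complex eigenvalue including 0.
    The eigenvalue 0 makes [[A B]] surjective, so that trajectories can be
    prolonged into the past and windows may start at any time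
    ([manifest_onP]).

    On a window of length [K] a trajectory is thus determined linearly by its
    initial slow state and [K + s - 1] inputs.  Shifts and linear combinations
    of trajectories are trajectories, so combinations of data windows are
    windows of trajectories.  Conversely it suffices that the data reach every
    pair of an initial slow state and [K + s - 1] inputs
    ([fundamental_span]), that is, that no nonzero row vector [(xi, eta)]
    annihilates all pairs of a data state and the following input window.

    From an annihilator [(xi, eta)] of depth [k] and a number [lam], delaying by
    one step and subtracting [lam] times the original gives an annihilator of
    depth [k + 1] with state part [xi (A - lam)].  After [q] steps through the
    complex eigenvalues of [A], the state part is zero by Cayley-Hamilton, and
    the input part, of depth [k + q], is zero by persistency of excitation.
    Undoing the steps one at a time, the input part stays zero and the state
    part [xi] satisfies [xi A = lam xi] and [xi B = 0], hence vanishes by the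
    Hautus condition ([annihilator_eq0]).  With [k = L + l + s - 1] the order
    of excitation used is [k + q = L + 2 l]. *)

(** * Windows of a signal and persistency of excitation *)

(** The nat-indexed form of a block row lets functionals on windows of
    different lengths be compared and shifted. *)
Lemma mxrow_nat (F : fieldType) d K (v : 'rV[F]_(\sum_(i < K) d)) :
  exists eta : nat -> 'rV[F]_d, v = \mxrow_(i < K) eta i.
Proof.
exists (fun i =>
  if insub i is Some o then @submxrow F K (fun=> d) 1 v o else 0).
by rewrite -[LHS]submxrowK; apply: eq_mxrow => o; rewrite valK.
Qed.

Section Windows.
Variables (F : fieldType) (d : nat).
Implicit Types (f : nat -> 'cV[F]_d) (eta : nat -> 'rV[F]_d).

(** The Hankel matrix over an arbitrary field, with [c] columns; it is also
    needed for the complexified data. *)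
Definition windows k c f : 'M[F]_(\sum_(i < k) d, c) :=
  \matrix_(i, j) (\mxcol_(i0 < k) f (j + i0)%N) i 0.

Definition shift_comb c (a : 'cV[F]_c) f (i : nat) : 'cV[F]_d :=
  \sum_(j < c) a j 0 *: f (j + i)%N.

Lemma windows_mulcol k c f (a : 'cV[F]_c) :
  windows k c f *m a = \mxcol_(i < k) shift_comb a f i.
Proof.
apply/matrixP => r z; rewrite (ord1 z) !mxE summxE.
by apply: eq_bigr => j _; rewrite !mxE mulrC.
Qed.

Lemma mulrow_windows k c eta f :
  \mxrow_(i < k) eta i *m windows k c f =
  \row_(j < c) (\sum_(i < k) eta i *m f (j + i)%N) 0 0.
Proof.
apply/rowP => j; rewrite [RHS]mxE -mul_mxrow_mxcol !mxE.
by apply: eq_bigr => r _; rewrite !mxE.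
Qed.

(** Persistency of excitation stated through functionals, which is the form
    that the delay argument consumes; it is full row rank of the Hankel matrix
    by [exciting_row_free]. *)
Definition exciting T K f := forall eta,
  (forall j, (j + K <= T)%N -> \sum_(i < K) eta i *m f (j + i)%N = 0) ->
  forall i, (i < K)%N -> eta i = 0.

Lemma exciting_row_free T K c f : (c + K = T.+1)%N ->
  exciting T K f <-> row_free (windows K c f).
Proof.
move=> cKT; split=> [exc | free eta eta0 i ltiK].
  apply: inj_row_free => v v0.
  have [eta vE] := mxrow_nat v.
  have eta0 : forall i, (i < K)%N -> eta i = 0.
    apply: exc => j jK; have ltjc : (j < c)%N by lia.
    apply/matrixP => a b; rewrite (ord1 a) (ord1 b).
    move: v0; rewrite vE mulrow_windows => /rowP /(_ (Ordinal ltjc)).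
    by rewrite !mxE.
  rewrite vE -mxrow0; apply: eq_mxrow => o; exact: eta0.
have : \mxrow_(i < K) eta i *m windows K c f = 0.
  rewrite mulrow_windows; apply/rowP => j.
  by rewrite !mxE eta0 ?mxE //; have := ltn_ord j; lia.
move/eqP; rewrite mulmx_free_eq0 // => /eqP.
move/(congr1 (fun M => submxrow M (Ordinal ltiK))).
by rewrite mxrowK submxrow0.
Qed.

End Windows.

Lemma map_windows (F G : fieldType) (h : {rmorphism F -> G}) d k c
    (f : nat -> 'cV[F]_d) :
  map_mx h (windows k c f) = windows k c (fun j => map_mx h (f j)).
Proof. by apply/matrixP => i j; rewrite !mxE. Qed.

(** * Annihilators of controllable, sufficiently excited data *)

(** The Popov-Belevitch-Hautus condition in terms of left eigenvectors; over an
    algebraically closed field it is controllability. *)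
Definition hautus (F : fieldType) q m (A : 'M[F]_q) (B : 'M_(q, m)) :=
  forall (lam : F) (v : 'rV_q), v *m A = lam *: v -> v *m B = 0 -> v = 0.

Section NoAnnihilator.
Variables (F : fieldType) (q m T : nat) (A : 'M[F]_q) (B : 'M[F]_(q, m)).
Variables (x : nat -> 'cV[F]_q) (u : nat -> 'cV[F]_m).
Hypothesis dyn : forall j, x j.+1 = A *m x j + B *m u j.
Hypothesis hautusAB : hautus A B.

Definition annihilates k (xi : 'rV[F]_q) (eta : nat -> 'rV[F]_m) :=
  forall j, (j + k <= T)%N ->
    xi *m x j + \sum_(i < k) eta i *m u (j + i)%N = 0.

(** Each [lam] of [rs] costs one unit of excitation and multiplies the state
    part by [A - lam]; once the state part is gone, excitation alone kills the
    input part, and the steps can be undone by the Hautus condition. *)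
Lemma annihilator_eq0 (rs : seq F) k xi eta :
  exciting T (k + size rs) u ->
  foldl (fun v lam => v *m A - lam *: v) xi rs = 0 ->
  annihilates k xi eta ->
  xi = 0 /\ forall i, (i < k)%N -> eta i = 0.
Proof.
elim: rs k xi eta => [|lam rs IH] k xi eta /=.
  rewrite addn0 => exc xi0 ann; split=> //; apply: exc => j /ann.
  by rewrite xi0 mul0mx add0r.
rewrite addnS -addSn => exc xi0 ann.
(* [eta'] is [eta] delayed by one step, the freed first place taking [xi B]
   because [xi A x j = xi x (j+1) - xi B u j], minus [lam] times [eta].  Both
   terms need the value 0 outside the window of length [k]. *)
pose trunc i := if (i < k)%N then eta i else 0.
pose eta' i := (if i is i'.+1 then trunc i' else xi *m B) - lam *: trunc i.
have sumE j : \sum_(i < k) trunc i *m u (j + i)%N =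
              \sum_(i < k) eta i *m u (j + i)%N.
  by apply: eq_bigr => i _; rewrite /trunc ltn_ord.
have [|xiA eta'0] := IH k.+1 (xi *m A - lam *: xi) eta' exc xi0.
  move=> j jk.
  have E : xi *m A *m x j = xi *m x j.+1 - xi *m B *m u j.
    by rewrite dyn mulmxDr !mulmxA addrK.
  have E1 : \sum_(i < k.+1)
      (if i : nat is i'.+1 then trunc i' else xi *m B) *m u (j + i)%N
     = xi *m B *m u j + \sum_(i < k) eta i *m u (j.+1 + i)%N.
    rewrite big_ord_recl /= addn0 -sumE; congr (_ + _).
    by apply: eq_bigr => i _; rewrite /bump /= add1n addnS addSn.
  have E2 : \sum_(i < k.+1) (lam *: trunc i) *m u (j + i)%N
     = lam *: \sum_(i < k) eta i *m u (j + i)%N.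
    rewrite big_ord_recr /= {2}/trunc ltnn scaler0 mul0mx addr0.
    rewrite -sumE scaler_sumr.
    by apply: eq_bigr => i _; rewrite scalemxAl.
  under eq_bigr do rewrite mulmxBl.
  rewrite sumrB E1 E2 mulmxBl E -scalemxAl.
  have /eqP := ann j.+1 ltac:(lia); rewrite addr_eq0 => /eqP ->.
  have /eqP := ann j ltac:(lia); rewrite addr_eq0 => /eqP ->.
  rewrite scalerN opprK.
  set a := \sum_(i < k) _; set b := _ *m u j; set c := lam *: _.
  by rewrite -opprD [a + b]addrC [- _ + c]addrC -[c - _]opprB addNr.
(* [eta' (i+1) = 0] says [eta i = lam * eta (i+1)], and [eta] is 0 from index
   [k] on, so [eta] vanishes by descending induction. *)
have trunc0 i : trunc i = 0.
  have [|] := leqP k i; first by rewrite /trunc ltnNge => ->.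
  move=> ltik; have [n] := ubnP (k - i)%N; elim: n i ltik => // n IHn i ltik lt.
  have := eta'0 i.+1 ltac:(lia); rewrite /eta'.
  have [lt'|ge] := ltnP i.+1 k.
    by rewrite (IHn i.+1) ?scaler0 ?subr0 //; lia.
  by rewrite {2}/trunc ltnNge ge /= scaler0 subr0.
have xiB : xi *m B = 0.
  by have := eta'0 0%N isT; rewrite /eta' trunc0 scaler0 subr0.
split; last by move=> i ik; have := trunc0 i; rewrite /trunc ik.
by apply: (hautusAB (lam := lam)) => //; apply/eqP; rewrite -subr_eq0 xiA.
Qed.

End NoAnnihilator.

(** The complex eigenvalues of [A], through Cayley-Hamilton. *)
Lemma annihilating_roots (F : closedFieldType) q (A : 'M[F]_q) :
  exists2 rs : seq F, size rs = q &
    forall xi : 'rV_q, foldl (fun v lam => v *m A - lam *: v) xi rs = 0.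
Proof.
case: q A => [|q] A; first by exists [::] => // xi; rewrite thinmx0.
have [rs] := closed_field_poly_normal (char_poly A).
rewrite (eqP (char_poly_monic A)) scale1r => defA; exists rs.
  by apply/eqP; rewrite -eqSS -(size_char_poly A) defA size_prod_XsubC.
have := Cayley_Hamilton A; rewrite defA rmorph_prod /= => prod0 xi.
rewrite -[RHS](mulmx0 _ xi) -[X in xi *m X]prod0 {defA prod0}.
elim: rs xi => [|lam rs IH] xi /=; first by rewrite big_nil mulmx1.
rewrite IH big_cons -mulmxE mulmxA; congr (_ *m _).
by rewrite rmorphB /= horner_mx_X horner_mx_C mulmxBr mul_mx_scalar.
Qed.

Section Fundamental.
Variables (R : realType) (q m : nat) (A : 'M[R]_q) (B : 'M[R]_(q, m)).
Hypothesis hautusAB : hautus (cmx A) (cmx B).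
Variables (x : nat -> 'cV[R]_q) (u : nat -> 'cV[R]_m).
Hypothesis dyn : forall j, x j.+1 = A *m x j + B *m u j.

(** Duality turns the absence of annihilators into the ability to prescribe the
    initial state and the first [k] inputs at once.  The eigenvalues of [A] are
    complex, so the annihilator argument runs over the complexified data. *)
Lemma fundamental_span T k c : (c + k = T.+1)%N -> (k + q <= T)%N ->
  exciting T (k + q) u ->
  forall (x0 : 'cV[R]_q) (v : nat -> 'cV[R]_m),
  exists a : 'cV[R]_c,
    shift_comb a x 0 = x0 /\ forall i, (i < k)%N -> shift_comb a u i = v i.
Proof.
move=> ckT lekqT exc x0 v.
pose X : 'M[R]_(q, c) := \matrix_(i, j) x j i 0.
pose M := col_mx X (windows k c u).
have freeM : row_free M.
  apply: inj_row_free => w; rewrite -[w]hsubmxK mul_row_col.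
  set xi := lsubmx w; set e := rsubmx w => w0.
  have [rs rsq rs0] := annihilating_roots (cmx A).
  have [eta eE] := mxrow_nat e.
  have excC : exciting T (k + size rs) (fun j => cmx (u j)).
    rewrite rsq; apply/(@exciting_row_free _ _ _ _ (c - q)); first lia.
    rewrite -[windows _ _ _](map_windows (real_complex R)) row_free_map.
    by apply/exciting_row_free; last exact: exc; lia.
  have dynC j : cmx (x j.+1) = cmx A *m cmx (x j) + cmx B *m cmx (u j).
    by rewrite dyn /cmx map_mxD !map_mxM.
  have [|xi0 eta0] := annihilator_eq0 (eta := fun i => cmx (eta i))
                        dynC hautusAB excC (rs0 (cmx xi)).
    move=> j jk; have ltjc : (j < c)%N by lia.
    transitivity (cmx (xi *m x j + \sum_(i < k) eta i *m u (j + i)%N)).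
      rewrite /cmx map_mxD map_mxM; congr (_ + _).
      by rewrite raddf_sum; apply: eq_bigr => i _; rewrite /= map_mxM.
    rewrite -[RHS](map_mx0 (real_complex R)); congr map_mx.
    apply/matrixP => a b; rewrite (ord1 a) (ord1 b) [RHS]mxE.
    move: w0; rewrite eE mulrow_windows => /rowP /(_ (Ordinal ltjc)).
    rewrite mxE [X in _ + X]mxE [RHS]mxE /= => <-; rewrite mxE; congr (_ + _).
    by rewrite !mxE; apply: eq_bigr => i _; rewrite !mxE.
  have inj0 d (z : 'rV[R]_d) : cmx z = 0 -> z = 0.
    by move/eqP; rewrite map_mx_eq0 => /eqP.
  rewrite (inj0 _ _ xi0) [e]eE -[RHS]row_mx0; congr row_mx.
  rewrite -mxrow0; apply: eq_mxrow => i; exact/inj0/eta0.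
exists (pinvmx M *m col_mx x0 (\mxcol_(i < k) v i)).
set a := pinvmx M *m _.
have : M *m a = col_mx x0 (\mxcol_(i < k) v i).
  by rewrite mulmxA mulmxVp // mul1mx.
rewrite mul_col_mx windows_mulcol => /eq_col_mx [Xa /eq_mxcolP ua]; split.
  rewrite -Xa; apply/colP => i; rewrite mxE summxE.
  by apply: eq_bigr => j _; rewrite !mxE addn0 mulrC.
by move=> i ik; exact: (ua (Ordinal ik)).
Qed.

End Fundamental.

(** * Elimination of the nilpotent part of the state *)

(** A nilpotent implicit equation has exactly one solution, found by iterating
    [z k = N z (k+1) - g k] until the power of [N] vanishes. *)
Lemma nilpotent_solution (R : realType) (r s : nat) (N : 'M[R]_r)
    (z g : nat -> 'cV[R]_r) : N ^+ s = 0 ->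
  (forall k, N *m z k.+1 = z k + g k) <->
  (forall k, z k = - \sum_(i < s) (N ^+ i) *m g (k + i)%N).
Proof.
move=> Ns0; split=> [eqz k | zE k].
  have zE j : z k = N ^+ j *m z (k + j)%N - \sum_(i < j) N ^+ i *m g (k + i)%N.
    elim: j => [|j IH].
      by rewrite big_ord0 subr0 addn0 expr0 mul1mx.
    rewrite IH big_ord_recr /= addnS exprSr -mulmxE -mulmxA eqz mulmxDr.
    by rewrite opprD addrA [in RHS]addrAC addrK.
  by rewrite (zE s) Ns0 mul0mx add0r.
rewrite !zE; case: s Ns0 {zE} => [|s] Ns0.
  (* [N ^+ 0 = 0] forces [r = 0]. *)
  have z0 (v : 'cV[R]_r) : v = 0.
    by rewrite -[v]mul1mx -[1%:M]/(1 : 'M_r) -[1](expr0 N) Ns0 mul0mx.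
  by rewrite [LHS]z0 [RHS]z0.
rewrite mulmxN mulmx_sumr big_ord_recr /= mulmxA mulmxE -exprS Ns0 mul0mx addr0.
rewrite big_ord_recl /= expr0 mul1mx addn0 opprD addrAC addNr add0r.
congr (- _); apply: eq_bigr => i _.
by rewrite mulmxA mulmxE -exprS /bump /= addnS addSn.
Qed.

(** The output is noncausal: it looks [s - 1] steps ahead, the trace left by
    the nilpotent part of the state. *)
Definition slow_trajectory (R : realType) q m p s (A : 'M[R]_q) (B : 'M_(q, m))
    (C : 'M_(p, q)) (F : nat -> 'M_(p, m)) (z : nat -> 'cV_q)
    (u : nat -> 'cV_m) (y : nat -> 'cV_p) :=
  (forall k, z k.+1 = A *m z k + B *m u k) /\
  (forall k, y k = C *m z k + \sum_(i < s) F i *m u (k + i)%N).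

(** A left eigenvector [v] of [A] with [v B = 0], padded with zeros on the
    nilpotent part, annihilates the transformed controllability pencil; this is
    why R-controllability gives the Hautus condition for the slow part. *)
Lemma quasi_weierstrass_slow_trajectory (R : realType) n m p q s
    (sys : descriptor R n m p) :
  quasi_weierstrass sys q s -> R_controllable sys ->
  exists (A : 'M_q) (B : 'M_(q, m)) (C : 'M_(p, q)) (F : nat -> 'M_(p, m)),
    hautus (cmx A) (cmx B) /\
    forall u y, manifest_behavior sys u y <->
                exists z, slow_trajectory s A B C F z u y.
Proof.
case=> r [qr_n [S [P [A1 [N [Su Pu EE AE [s_gt0 Ns0 _]]]]]]] ctrb.
subst n; rewrite !castmx_id in EE AE.
case: sys => E A B C D in EE AE ctrb *; rewrite /= in EE AE.
pose B1 := usubmx (S *m B); pose B2 := dsubmx (S *m B).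
pose C1 := lsubmx (C *m P); pose C2 := rsubmx (C *m P).
have SB : S *m B = col_mx B1 B2 by rewrite vsubmxK.
have CP : C *m P = row_mx C1 C2 by rewrite hsubmxK.
(* The feedthrough [D] acts on the present input only. *)
pose F i := (if i == 0%N then D else 0) - C2 *m (N ^+ i) *m B2.
exists A1, B1, C1, F; split=> [lam v vA vB | u y].
  set M := row_mx (pencil (Descriptor E A B C D) lam) (cmx B).
  have freeM : row_free M by rewrite /row_free [\rank _]ctrb.
  have cSu : cmx S \in unitmx by rewrite map_unitmx.
  have cPu : cmx P \in unitmx by rewrite map_unitmx.
  pose w := row_mx v (0 : 'rV_r) *m cmx S.
  have w0 : w *m M = 0.
    rewrite mul_mx_row /pencil /=.
    have -> : w *m cmx B = 0.
      rewrite -mulmxA /cmx -map_mxM SB map_col_mx mul_row_col mul0mx addr0.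
      exact: vB.
    suff : w *m (lam *: cmx E - cmx A) *m cmx P = 0.
      move/(congr1 (mulmx^~ (invmx (cmx P)))); rewrite mulmxK // mul0mx => ->.
      by rewrite row_mx0.
    have -> : w *m (lam *: cmx E - cmx A) *m cmx P =
        row_mx v 0 *m (lam *: cmx (S *m E *m P) - cmx (S *m A *m P)).
      rewrite /cmx !map_mxM !(mulmxBr, mulmxBl) -!scalemxAr -!scalemxAl.
      by rewrite !mulmxA.
    rewrite EE AE mulmxBr -scalemxAr /cmx !map_block_mx !mul_row_block.
    rewrite !map_mx0 !map_mx1 !mul0mx !mulmx0.
    rewrite !addr0 mulmx1 scale_row_mx scaler0 -/(cmx A1) vA.
    by rewrite subrr.
  have {w0} : w == 0 by rewrite -(mulmx_free_eq0 _ freeM) w0.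
  move/eqP/(congr1 (mulmx^~ (invmx (cmx S)))); rewrite mulmxK // mul0mx.
  by move/(congr1 lsubmx); rewrite row_mxKl linear0.
have fullE x :
  full_behavior (Descriptor E A B C D) (fun k => P *m x k) u y <->
  forall k, [/\ usubmx (x k.+1) = A1 *m usubmx (x k) + B1 *m u k,
     N *m dsubmx (x k.+1) = dsubmx (x k) + B2 *m u k &
     y k = C1 *m usubmx (x k) + C2 *m dsubmx (x k) + D *m u k].
  rewrite /full_behavior /=.
  have stE k : E *m (P *m x k.+1) = A *m (P *m x k) + B *m u k <->
    usubmx (x k.+1) = A1 *m usubmx (x k) + B1 *m u k /\
     N *m dsubmx (x k.+1) = dsubmx (x k) + B2 *m u k.
    have -> : E *m (P *m x k.+1) = A *m (P *m x k) + B *m u k <->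
       S *m E *m P *m x k.+1 = S *m A *m P *m x k + S *m B *m u k.
      rewrite -!mulmxA -mulmxDr; split=> [-> //|].
      by move/(congr1 (mulmx (invmx S))); rewrite !mulKmx.
    rewrite EE AE SB -{1}[x k.+1]vsubmxK -{1}[x k]vsubmxK.
    rewrite !mul_block_col mul_col_mx.
    rewrite !mul0mx !mul1mx addr0 !add0r addr0 add_col_mx.
    by split=> [/eq_col_mx //|[-> ->]].
  have outE k : C *m (P *m x k) = C1 *m usubmx (x k) + C2 *m dsubmx (x k).
    by rewrite mulmxA CP -{1}[x k]vsubmxK mul_row_col.
  split=> H k; have := H k; rewrite outE.
    by case=> /stE [].
  by case=> h1 h2 h3; split=> //; apply/stE.
have outE (z : nat -> 'cV_q) k :
    C1 *m z k + C2 *m (- \sum_(i < s) (N ^+ i) *m (B2 *m u (k + i)%N))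
      + D *m u k =
    C1 *m z k + \sum_(i < s) F i *m u (k + i)%N.
  rewrite -addrA; congr (_ + _).
  under [in RHS]eq_bigr do rewrite mulmxBl.
  rewrite sumrB addrC mulmxN mulmx_sumr; congr (_ - _).
    rewrite -(prednK s_gt0) big_ord_recl /= addn0 big1 ?addr0 // => i _.
    by rewrite mul0mx.
  by apply: eq_bigr => i _; rewrite !mulmxA.
split=> [[x full]|[z [zdyn yE]]].
  pose x' k := invmx P *m x k.
  have /fullE {full} full :
      full_behavior (Descriptor E A B C D) (fun k => P *m x' k) u y.
    by move=> k; rewrite /x' !mulKVmx.
  have fast : forall k, N *m dsubmx (x' k.+1) = dsubmx (x' k) + B2 *m u k.
    by move=> k; have [] := full k.
  move/(@nilpotent_solution _ _ s) : fast => /(_ Ns0) fast.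
  exists (fun k => usubmx (x' k)); split=> k; have [h1 _ h3] := full k => //.
  by rewrite h3 fast (outE (fun k => usubmx (x' k))).
pose z2 k := - \sum_(i < s) (N ^+ i) *m (B2 *m u (k + i)%N).
exists (fun k => P *m col_mx (z k) (z2 k)).
apply/fullE => k; rewrite !col_mxKu !col_mxKd; split; first exact: zdyn.
  by apply: (proj2 (nilpotent_solution z2 (fun k => B2 *m u k) Ns0)).
by rewrite yE outE.
Qed.

(** * Shifting and combining trajectories *)

Lemma mulmx_shift_comb (F : fieldType) d e c (M : 'M[F]_(e, d))
    (a : 'cV[F]_c) f i :
  M *m shift_comb a f i = shift_comb a (fun k => M *m f k) i.
Proof. by rewrite mulmx_sumr; apply: eq_bigr => j _; rewrite scalemxAr. Qed.

Lemma shift_combD (F : fieldType) d c (a : 'cV[F]_c) (f g : nat -> 'cV[F]_d) i :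
  shift_comb a f i + shift_comb a g i = shift_comb a (fun k => f k + g k) i.
Proof. by rewrite -big_split; apply: eq_bigr => j _; rewrite scalerDr. Qed.

Lemma eq_shift_comb (F : fieldType) d c (a : 'cV[F]_c)
    (f g : nat -> 'cV[F]_d) i :
  (forall j, (j < c)%N -> f (j + i)%N = g (j + i)%N) ->
  shift_comb a f i = shift_comb a g i.
Proof. by move=> fg; apply: eq_bigr => j _; rewrite fg. Qed.

Lemma shift_combS (F : fieldType) d c (a : 'cV[F]_c) (f : nat -> 'cV[F]_d) i :
  shift_comb a f i.+1 = shift_comb a (fun k => f k.+1) i.
Proof. by apply: eq_bigr => j _; rewrite addnS. Qed.

Lemma at_time_val (R : realType) d a len (f : window a len -> 'cV[R]_d) i
    (lti : (a <= i < a + len)%N) :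
  at_time f i = f (exist _ i lti).
Proof. by rewrite /at_time insubT. Qed.

Section Behavior.
Variables (R : realType) (n m p : nat) (sys : descriptor R n m p).

Lemma manifest_shift a u y : manifest_behavior sys u y ->
  manifest_behavior sys (fun k => u (a + k)%N) (fun k => y (a + k)%N).
Proof.
case=> x full; exists (fun k => x (a + k)%N) => k.
by rewrite addnS; apply: full.
Qed.

Lemma manifest_shift_comb c (a : 'cV[R]_c) u y : manifest_behavior sys u y ->
  manifest_behavior sys (shift_comb a u) (shift_comb a y).
Proof.
case=> x full; exists (shift_comb a x) => k.
rewrite !mulmx_shift_comb !shift_combD shift_combS; split;
  by apply: eq_shift_comb => j _; have [] := full (j + k)%N.
Qed.

Variables (q s : nat).
Hypothesis sys_qs : quasi_weierstrass sys q s.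
Hypothesis sys_ctrb : R_controllable sys.

(** The Hautus condition at the eigenvalue 0. *)
Lemma hautus_row_free (A : 'M[R]_q) (B : 'M_(q, m)) :
  hautus (cmx A) (cmx B) -> row_free (row_mx A B).
Proof.
move=> hAB; apply: inj_row_free => v; rewrite mul_mx_row -row_mx0.
move/eq_row_mx => [vA vB]; apply/eqP; rewrite -(map_mx_eq0 (real_complex R)).
apply/eqP/(hAB 0); first by rewrite /cmx -map_mxM vA map_mx0 scale0r.
by rewrite /cmx -map_mxM vB map_mx0.
Qed.

(** Since [[A B]] is surjective, every slow state has a predecessor. *)
Lemma manifest_predecessor u y : manifest_behavior sys u y ->
  exists u' y', manifest_behavior sys u' y' /\
    forall k, u' k.+1 = u k /\ y' k.+1 = y k.
Proof.
have [A [B [C [F [hAB manE]]]]] :=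
  quasi_weierstrass_slow_trajectory sys_qs sys_ctrb.
move=> /manE [z [zdyn yE]].
have /row_freeP [V ABV] := hautus_row_free hAB.
pose w := V *m z 0%N.
have z0 : z 0%N = A *m usubmx w + B *m dsubmx w.
  by rewrite -mul_row_col vsubmxK mulmxA ABV mul1mx.
pose z' k := if k is k'.+1 then z k' else usubmx w.
pose u' k := if k is k'.+1 then u k' else dsubmx w.
pose y' k := C *m z' k + \sum_(i < s) F i *m u' (k + i)%N.
exists u', y'; split.
  by apply/manE; exists z'; split=> // -[|k]; [exact: z0 | exact: zdyn].
by move=> k; split=> //; rewrite yE /y'.
Qed.

Lemma manifest_delay a u y : manifest_behavior sys u y ->
  exists u' y', manifest_behavior sys u' y' /\
    forall k, u' (a + k)%N = u k /\ y' (a + k)%N = y k.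
Proof.
elim: a u y => [|a IH] u y; first by exists u, y.
move=> /IH [u1 [y1 [/manifest_predecessor [u2 [y2 [man2 E2]]] E1]]].
exists u2, y2; split=> // k; rewrite addSn.
by have [-> ->] := E2 (a + k)%N; exact: E1.
Qed.

(** Time invariance: what can be seen on a window starting at [a] can be seen
    on one starting at 0, and conversely. *)
Lemma manifest_onP a len (u : window a len -> 'cV[R]_m)
    (y : window a len -> 'cV[R]_p) :
  manifest_on sys u y <->
  exists v w, manifest_behavior sys v w /\ forall i, (i < len)%N ->
    at_time u (a + i)%N = v i /\ at_time y (a + i)%N = w i.
Proof.
split=> [[u' [y' [man uE yE]]] | [v [w [man0 E]]]]; last first.
  have [u' [y' [man E']]] := manifest_delay a man0.
  have val_split (k : window a len) :
      exists2 i, (i < len)%N & val k = (a + i)%N.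
    by exists (val k - a)%N; case: k => k /= lek; lia.
  have atE d (f : window a len -> 'cV[R]_d) k : f k = at_time f (val k).
    by rewrite /at_time valK.
  exists u', y'; split=> // k; have [i lti ki] := val_split k;
    by rewrite atE ki; have [u'i y'i] := E' i; rewrite ?u'i ?y'i;
      have [] := E i lti.
exists (fun k => u' (a + k)%N), (fun k => y' (a + k)%N).
split; first exact: manifest_shift.
move=> i lti; have lt' : (a <= a + i < a + len)%N by lia.
by rewrite !(at_time_val _ lt') uE yE.
Qed.

(** * The fundamental lemma *)

Variables (T K c : nat) (ud : nat -> 'cV[R]_m) (yd : nat -> 'cV[R]_p).

(** The combination matching the initial slow state and the first [K + s - 1]
    inputs matches the slow states and the outputs on the whole window: the
    last output, at time [K - 1], looks [s - 1] inputs further. *)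
Lemma fundamental_lemma :
  manifest_behavior sys ud yd -> (c + (K + s - 1) = T.+1)%N -> (0 < s)%N ->
  (K + s - 1 + q <= T)%N -> exciting T (K + s - 1 + q) ud ->
  forall v w, (exists v' w', manifest_behavior sys v' w' /\
     forall i, (i < K)%N -> v i = v' i /\ w i = w' i) <->
  exists a : 'cV[R]_c, forall i, (i < K)%N ->
     v i = shift_comb a ud i /\ w i = shift_comb a yd i.
Proof.
move=> dman cT s_gt0 leT exc v w.
split=> [[v' [w' [man E]]] | [a aE]]; last first.
  exists (shift_comb a ud), (shift_comb a yd); split=> //.
  exact: manifest_shift_comb.
have [A [B [C [F [hAB manE]]]]] :=
  quasi_weierstrass_slow_trajectory sys_qs sys_ctrb.
have [x [xdyn ydE]] := proj1 (manE _ _) dman.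
have [z [zdyn wE]] := proj1 (manE _ _) man.
have [a [xa ua]] := fundamental_span hAB xdyn cT leT exc (z 0%N) v'.
have za i : (i < K)%N -> shift_comb a x i = z i.
  elim: i => // i IH lti; rewrite shift_combS zdyn -IH; last by lia.
  rewrite -ua ?mulmx_shift_comb ?shift_combD; last by lia.
  by apply: eq_shift_comb => j _; exact: xdyn.
exists a => i lti; have [-> ->] := E i lti; split; first by rewrite ua //; lia.
have -> : shift_comb a yd i =
    C *m shift_comb a x i + \sum_(h < s) F h *m shift_comb a ud (i + h)%N.
  rewrite mulmx_shift_comb.
  transitivity (shift_comb a (fun k => C *m x k) i +
       shift_comb a (fun k => \sum_(h < s) F h *m ud (k + h)%N) i).
    by rewrite shift_combD; apply: eq_shift_comb => j _; exact: ydE.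
  congr (_ + _); rewrite /shift_comb.
  under eq_bigr do rewrite scaler_sumr.
  rewrite exchange_big /=; apply: eq_bigr => h _.
  rewrite mulmx_sumr; apply: eq_bigr => j _.
  by rewrite scalemxAr addnA.
rewrite wE za //; congr (_ + _); apply: eq_bigr => h _.
by rewrite ua //; have := ltn_ord h; lia.
Qed.

End Behavior.

(** * Equivalence of the two optimal control problems *)

Lemma hankel_windows (R : realType) d K len (f : nat -> 'cV[R]_d) :
  hankel K 0 len f = windows K (len - K + 1) f.
Proof. by apply/matrixP => i j; rewrite !mxE. Qed.

Lemma stack_eq_hankel (R : realType) d a K len (f g : nat -> 'cV[R]_d) alpha :
  stack a K f = hankel K 0 len g *m alpha <->
  forall i, (i < K)%N -> f (a + i)%N = shift_comb alpha g i.
Proof.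
rewrite hankel_windows windows_mulcol /stack; split=> [/eq_mxcolP H i lti | H].
  exact: (H (Ordinal lti)).
by apply: eq_mxcol => i; exact: H.
Qed.

Lemma persistently_exciting_exciting (R : realType) m T K
    (u : window 0 T -> 'cV[R]_m) (f : nat -> 'cV[R]_m) :
  persistently_exciting u K -> (forall i, (i < T)%N -> at_time u i = f i) ->
  exciting T K f.
Proof.
case=> /andP[K_gt0 leKT] rkH uf eta ann.
have : exciting T K (at_time u).
  apply/(@exciting_row_free _ _ _ _ (T - K + 1)); first lia.
  by rewrite -hankel_windows /row_free rkH sum_nat_const card_ord mulnC.
apply=> j jK; rewrite -[RHS](ann j jK); apply: eq_bigr => i _.
by rewrite uf //; have := ltn_ord i; lia.
Qed.

(** The data windows end by time [T - s]: the outputs there depend on inputs up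
    to time [T - 1] only, whereas later outputs may involve inputs beyond the
    data. *)
Lemma ocp_constraints_equiv (R : realType) n m p (sys : descriptor R n m p)
    q s L T t (l := (q + s - 1)%N)
    (u : window (t - l) l -> 'cV[R]_m) (y : window (t - l) l -> 'cV[R]_p)
    (ubar : window 0 T -> 'cV[R]_m) (ybar : window 0 T -> 'cV[R]_p) w :
  R_controllable sys -> quasi_weierstrass sys q s -> (0 < L)%N ->
  manifest_on sys ubar ybar -> persistently_exciting ubar (L + 2 * l) ->
  ocpA_constraints (L := L) sys u y w <->
  exists alpha, ocpB_constraints (L := L) (s := s) ubar ybar u y (w, alpha).
Proof.
move=> ctrb qs L_gt0 dman pe.
suff E : manifest_on sys w.1 w.2 <-> exists alpha : 'cV_(alpha_dim l L T s),
    col_mx (stack (t - l) (L + l) (at_time w.1))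
           (stack (t - l) (L + l) (at_time w.2)) =
    col_mx (hankel (L + l) 0 (T - s + 1) (at_time ubar))
           (hankel (L + l) 0 (T - s + 1) (at_time ybar)) *m alpha.
  split=> [[/E[alpha aE] i t0]|[alpha [aE i t0]]]; first by exists alpha.
  by split=> //; apply/E; exists alpha.
have s_gt0 : (0 < s)%N by case: qs => r [? [? [? [? [? [_ _ _ _ []]]]]]].
have /andP[_ leT] := proj1 pe.
have [ud [yd [dman' dE]]] := proj1 (manifest_onP qs ctrb _ _) dman.
have exc : exciting T (L + l + s - 1 + q) ud.
  have -> : (L + l + s - 1 + q = L + 2 * l)%N by lia.
  by apply: persistently_exciting_exciting pe _ => i ltiT; have [] := dE i ltiT.
have cT : (alpha_dim l L T s + (L + l + s - 1) = T.+1)%N.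
  by rewrite /alpha_dim; lia.
have leT' : (L + l + s - 1 + q <= T)%N by lia.
have fund := fundamental_lemma qs ctrb dman' cT s_gt0 leT' exc.
have combE d (f : window 0 T -> 'cV[R]_d) g
    (alpha : 'cV_(alpha_dim l L T s)) i :
    (forall j, (j < T)%N -> at_time f j = g j) -> (i < L + l)%N ->
    shift_comb alpha (at_time f) i = shift_comb alpha g i.
  by move=> fg lti; apply: eq_shift_comb => j ltj; apply: fg; lia.
apply: (iff_trans (manifest_onP qs ctrb _ _)).
apply: (iff_trans (fund (fun i => at_time w.1 (t - l + i)%N)
                        (fun i => at_time w.2 (t - l + i)%N))).
have ubarE j : (j < T)%N -> at_time ubar j = ud j by move=> /dE[].
have ybarE j : (j < T)%N -> at_time ybar j = yd j by move=> /dE[].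
split=> [][alpha]; rewrite ?mul_col_mx.
  move=> aE; exists alpha; rewrite mul_col_mx.
  congr col_mx; apply/stack_eq_hankel => i lti.
    by have [-> _] := aE i lti; rewrite (combE _ _ _ _ _ ubarE).
  by have [_ ->] := aE i lti; rewrite (combE _ _ _ _ _ ybarE).
move=> /eq_col_mx[/stack_eq_hankel uE /stack_eq_hankel yE].
exists alpha => i lti.
by rewrite uE // yE // (combE _ _ _ _ _ ubarE) // (combE _ _ _ _ _ ybarE).
Qed.

Theorem proposition9 (R : realType) (n m p : nat) (sys : descriptor R n m p)
    (q s L T t : nat) (Q : 'M[R]_p) (W : 'M[R]_m)
    (u : window (t - (q + s - 1)) (q + s - 1) -> 'cV[R]_m)
    (y : window (t - (q + s - 1)) (q + s - 1) -> 'cV[R]_p)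
    (ubar : window 0 T -> 'cV[R]_m) (ybar : window 0 T -> 'cV[R]_p)
    (sys_regular : regular sys)
    (sys_controllable : R_controllable sys)
    (sys_observable : R_observable sys)
    (sys_qs : quasi_weierstrass sys q s)
    (L_pos : (0 < L)%N) (T_pos : (0 < T)%N)
    (Q_posdef : sym_posdef Q) (W_posdef : sym_posdef W)
    (t_large : (q + s - 1 <= t)%N)
    (uy_traj : manifest_on sys u y)
    (data_traj : manifest_on sys ubar ybar)
    (data_pe : persistently_exciting ubar (L + 2 * (q + s - 1))) :
  let l := (q + s - 1)%N in
  let consA := ocpA_constraints (L := L) sys u y in
  let costA := ocp_cost (l := l) (L := L) (t := t) Q W in
  let consB := ocpB_constraints (L := L) (s := s) ubar ybar u y in
  let costB := ocpB_cost (l := l) (L := L) (t := t) (T := T) (s := s) Q W in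
  [/\ feasible consA <-> feasible consB,
      forall ustar ystar, optimal consA costA (ustar, ystar) ->
        exists alpha : 'cV[R]_(alpha_dim (q + s - 1) L T s),
          optimal consB costB (ustar, ystar, alpha)
    & forall ustar ystar (alpha : 'cV[R]_(alpha_dim (q + s - 1) L T s)),
        optimal consB costB (ustar, ystar, alpha) ->
        manifest_on sys ustar ystar /\ optimal consA costA (ustar, ystar)].
Proof.
move=> l consA costA consB costB.
have consAB w : consA w <-> exists alpha, consB (w, alpha).
  exact: ocp_constraints_equiv.
split.
- split=> [[w /consAB[alpha cB]]|[[w alpha] cB]]; first by exists (w, alpha).
  by exists w; apply/consAB; exists alpha.
- move=> us ys [/consAB[alpha cB] opt]; exists alpha; split=> // -[w' a'] cB'.
  by apply: opt; apply/consAB; exists a'.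
- move=> us ys alpha [cB opt].
  have cA : consA (us, ys) by apply/consAB; exists alpha.
  split; first by case: cA.
  split=> // w' /consAB[a' cB']; exact: opt (w', a') cB'.
Qed.
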